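(* Let $T$ be an expandable tree and let $\mathcal{T}\subseteq\{0,1\}^T$ be a tree-shift on $T$ over $\{0,1\}$. Then the following are equivalent: (1) $\mathcal{T}$ has positive surface entropy, $h^{(S)}(\mathcal{T})>0$; (2) $\mathcal{T}$ has the boundary independence property.
   Context: Trees. A tree $T$ is a countable, locally finite (connected) graph without loops (cycles), with a root $\epsilon$, whose vertices are represented as words over $d$ generators $g_1,\dots,g_d$: $T$ is a set of finite words over $\{g_1,\dots,g_d\}$ containing the empty word $\epsilon$ and closed under taking prefixes, with an edge from $g$ to $gg_i$ whenever both are in $T$. $T_n$ is the set of vertices of $T$ of length $n$ (at distance $n$ from $\epsilon$), and $\Delta_n=\bigcup_{i=0}^nT_i$. The expanding number of $T$ is $\gamma_T=\lim_{n\to\infty}|T_{n+1}|/|T_n|$, whenever this limit exists. $T$ is expandable if $\gamma_T$ exists and $\gamma_T>1$. Tree-shifts. For a finite alphabet $\mathcal{A}$, a labeled tree is a function $t:T\to\mathcal{A}$, written $t=(t_g)_{g\in T}$. A tree-shift $\mathcal{T}\subseteq\mathcal{A}^T$ is the set of all labeled trees that avoid every member of some given set of forbidden blocks, where a block is a labeling $p:F\to\mathcal{A}$ of a finite nonempty set $F$ of words over the generators, and $t$ avoids $p$ if there is no $g\in T$ with $gF\subseteq T$ and $t_{gh}=p_h$ for all $h\in F$. The (topological) surface entropy is $$h^{(S)}(\mathcal{T})=\limsup_{n\to\infty}\frac{\log|B_n^{(S)}(\mathcal{T})|}{|T_n|},\qquad B_n^{(S)}(\mathcal{T})=\{t|_{T_n}:t\in\mathcal{T}\}.$$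 Independence. $S\subseteq T$ is an independence set of $\mathcal{T}\subseteq\mathcal{A}^T$ if for every $u\in\mathcal{A}^S$ there is $t\in\mathcal{T}$ with $t_g=u_g$ for all $g\in S$. $\mathcal{T}$ has the boundary independence property if there exist $l\ge1$ and a sequence $\{S_n\}_{n=l}^\infty$ of subsets of $T$ such that (i) $S_n\subseteq\Delta_n\setminus\Delta_{n-l}$ for all $n\ge l$, (ii) each $S_n$ is an independence set of $\mathcal{T}$, and (iii) $\limsup_{n\to\infty}\frac{|S_n\cap\Delta_n|}{|\Delta_n|}>0$. *)

(* Defs.v *)
From mathcomp Require Export all_boot all_order all_algebra finmap.
From mathcomp Require Export all_classical all_reals all_analysis.
Export numFieldNormedType.Exports.

Set Implicit Arguments.
Unset Strict Implicit.
Unset Printing Implicit Defensive.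

Local Open Scope classical_set_scope.
Local Open Scope ring_scope.

Notation word d := (seq 'I_d).

(* The cardinality of a finite set; the value is 0 on infinite sets, but every
   set it is applied to below is finite. *)
Definition card (U : choiceType) (S : set U) : nat := #|` fset_set S|%fset.

(* A word is the vertex reached from the root [::] by reading it from left to
   right, so the children of g are the words rcons g i; connectedness,
   acyclicity and local finiteness are automatic. *)
Definition is_tree (d : nat) (T : set (word d)) : Prop :=
  T [::] /\ forall u v : word d, prefix u v -> T v -> T u.

(* Vertices of T are elements of the type {g : word d | g \in T} to which
   the set T coerces. *)
Definition level (d : nat) (T : set (word d)) (n : nat) : set T :=
  [set g : T | size (val g) = n].
Arguments level {d} T n _.

Definition initial (d : nat) (T : set (word d)) (n : nat) : set T :=
  \bigcup_(i in [set i : nat | (i <= n)%N]) level T i.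
Arguments initial {d} T n _.

Section ExpandingNumber.
Variables (R : realType) (d : nat) (T : set (word d)).

(* If T is finite the ratio is eventually 0 / 0 = 0; then T is not
   expandable, as it should be. *)
Definition growth_ratio (n : nat) : R :=
  (card (level T n.+1))%:R / (card (level T n))%:R.

Definition expanding_number : R := limn growth_ratio.

Definition expandable : Prop := cvgn growth_ratio /\ 1 < expanding_number.

End ExpandingNumber.

Section TreeShift.
Variables (d : nat) (T : set (word d)) (A : finType).

(* The support domf p of a block is any nonempty finite set of words; it need
   not be contained in T. *)
Definition is_block (p : {fmap word d -> A}) : Prop := domf p != fset0.

(* v is the vertex gh, which in particular is required to lie in T. *)
Definition occurs_at (t : T -> A) (p : {fmap word d -> A}) (g : T) : Prop :=
  forall h : domf p, exists v : T, val v = val g ++ val h /\ t v = p h.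

Definition avoids (t : T -> A) (p : {fmap word d -> A}) : Prop :=
  ~ exists g : T, occurs_at t p g.

Definition is_tree_shift (X : set (T -> A)) : Prop :=
  exists2 F : set {fmap word d -> A},
    (forall p, F p -> is_block p) &
    X = [set t | forall p, F p -> avoids t p].

Definition restrict_to (S : set T) (t : T -> A) : S -> A :=
  fun g : S => t (val g).

Definition level_patterns (X : set (T -> A)) (n : nat) : set (level T n -> A) :=
  restrict_to (S := level T n) @` X.
Arguments level_patterns X n _ : clear implicits.

(* lne 0 = -oo, so the empty tree-shift has surface entropy -oo when T is
   infinite. *)
Definition surface_entropy (R : realType) (X : set (T -> A)) : \bar R :=
  limn_esup (fun n => (lne (card (level_patterns X n))%:R%:E
                       / (card (level T n))%:R%:E)%E).

Definition independence_set (X : set (T -> A)) (S : set T) : Prop :=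
  forall u : S -> A, exists2 t : T -> A, X t & forall g : S, t (val g) = u g.

Definition boundary_independence (R : realType) (X : set (T -> A)) : Prop :=
  exists (l : nat) (S : nat -> set T),
    [/\ (1 <= l)%N,
        forall n, (l <= n)%N -> S n `<=` initial T n `\` initial T (n - l),
        forall n, (l <= n)%N -> independence_set X (S n) &
        (0 < limn_esup (fun n =>
           ((card (S n `&` initial T n))%:R
            / (card (initial T n))%:R : R)%:E))%E].

End TreeShift.

Arguments restrict_to {d T A} S t.
Arguments level_patterns {d T A} X n _.

(* Main.v *)
Require Import Defs.
From mathcomp Require Import zify ring lra.
Import Order.TTheory GRing.Theory Num.Theory.

(** Positive surface entropy means that, for some e > 0 and infinitely many n,
    the 0-1 patterns of the shift on level n number more than
    exp(e |T_n|).  Seen as a family of subsets of T_n, such an exponentially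
    large family must shatter a set of size proportional to |T_n|
    (large_shattered_set), and a shattered set of vertices is the same thing
    as an independence set (independence_shatters).  The shattered set comes
    from Pajor's form of the Sauer-Shelah lemma: a family of sets shatters at
    least as many sets as it has members (pajor), while there are too few
    small subsets of T_n to account for exp(e |T_n|) of them.  This gives
    independence sets S_n inside T_n, hence within Delta_n \ Delta_(n-1), with
    |S_n| >= (e^2/4) |T_n| infinitely often.  By expandability,
    the levels eventually grow geometrically, hence |Delta_n| is at most a
    constant times |T_n| (initial_le_level), so S_n also has positive density
    in Delta_n.

    Conversely, an independence set of density at least e in Delta_n that lies
    in the last l levels meets one of these levels T_j in at least
    (e/l) |Delta_n| >= (e/l) |T_j| vertices (pigeonhole_card).  Subsets of
    independence sets are independent, so T_j carries at least
    2^((e/l) |T_j|) patterns (independence_card).  Since n - l < j <= n, such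
    levels j are arbitrarily deep, and the surface entropy is at least
    (e/l) ln 2. *)

Set Implicit Arguments.
Unset Strict Implicit.
Unset Printing Implicit Defensive.
Local Open Scope classical_set_scope.
Local Open Scope ring_scope.

(** * Families of sets and the sets they shatter *)

Definition shatters (V : finType) (F : {set {set V}}) (S : {set V}) : bool :=
  powerset S \subset [set A :&: S | A in F]%SET.

Lemma shattersP (V : finType) (F : {set {set V}}) (S : {set V}) :
  reflect (forall B : {set V}, B \subset S ->
             exists2 A : {set V}, A \in F & A :&: S = B)
          (shatters F S).
Proof.
apply: (iffP fintype.subsetP) => [sh B BS|sh B].
  have /imsetP[A AF ->] := sh B ltac:(by rewrite powersetE).
  by exists A.
by rewrite powersetE => /sh[A AF <-]; apply: imset_f.
Qed.

Lemma shatters_mono (V : finType) (F G : {set {set V}}) (S : {set V}) :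
  F \subset G -> shatters F S -> shatters G S.
Proof.
by move=> FG sh; apply: fintype.subset_trans sh _; exact: imsetS.
Qed.

Lemma shatters_card (V : finType) (F : {set {set V}}) (S : {set V}) :
  shatters F S -> (2 ^ #|S| <= #|F|)%N.
Proof.
rewrite -card_powerset => /subset_leq_card sh.
exact: leq_trans sh (leq_imset_card _ _).
Qed.

(** When x does not separate the members of F, no two traces of F on S can
    differ at x; this keeps x out of the sets shattered by the two halves
    in the induction below. *)
Lemma shatters_notin (V : finType) (F : {set {set V}}) (S : {set V}) x b :
  (forall A : {set V}, A \in F -> (x \in A) = b) -> shatters F S -> x \notin S.
Proof.
move=> Fx /shattersP sh; apply/negP => xS.
have /sh[A /Fx xA /finset.setP/(_ x)] :
    (if b then finset.set0 else [set x])%SET \subset S.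
  by case: b {Fx} => /=; rewrite ?finset.sub0set ?finset.sub1set.
by rewrite inE xA xS andbT; case: b {Fx xA} => /=; rewrite !inE ?eqxx.
Qed.

(** Induction on the size of F.  Choose a point x that separates two members
    of F, and split F into F1 (members containing x) and F0.  Neither half
    shatters a set containing x.  A set shattered by either half is shattered
    by F, and if S is shattered by both halves then F shatters x |: S as well;
    so F shatters at least as many sets as F1 and F0 do in total. *)
Lemma pajor (V : finType) (F : {set {set V}}) :
  (#|F| <= #|[set S | shatters F S]%SET|)%N.
Proof.
have [n] := ubnP #|F|; elim: n F => // n IH F leF.
have [F_le1|] := leqP #|F| 1.
  have [->|[A AF]] := set_0Vmem F; first by rewrite cards0.
  apply: (leq_trans F_le1); apply/card_gt0P; exists finset.set0.
  rewrite inE; apply/shattersP => B; rewrite finset.subset0 => /eqP->.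
  by exists A; rewrite // finset.setI0.
case/card_gt1P=> A [B [AF BF AB]].
have [x xAB] : exists x, (x \in A) != (x \in B).
  apply/existsP; apply: contraNT AB; rewrite negb_exists => /forallP eqAB.
  by apply/eqP/finset.setP => x; apply/eqP; move: (eqAB x); rewrite negbK.
pose F1 := [set C in F | x \in C]%SET; pose F0 := [set C in F | x \notin C]%SET.
have F1E : F1 = (F :&: [set C : {set V} | x \in C])%SET.
  by apply/finset.setP => C; rewrite !inE.
have F0E : F0 = (F :\: [set C : {set V} | x \in C])%SET.
  by apply/finset.setP => C; rewrite !inE andbC.
have cardF : #|F| = (#|F1| + #|F0|)%N.
  by rewrite F1E F0E cardsID.
have [F1_gt0 F0_gt0] : (0 < #|F1|)%N /\ (0 < #|F0|)%N.
  case xA : (x \in A) xAB => xB; split; apply/card_gt0P.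
  - by exists A; rewrite inE AF.
  - by exists B; rewrite inE BF; case: (x \in B) xB.
  - by exists B; rewrite inE BF; case: (x \in B) xB.
  - by exists A; rewrite inE AF xA.
have le1 := IH F1 ltac:(lia); have le0 := IH F0 ltac:(lia).
set s1 := [set S | shatters F1 S]%SET in le1.
set s0 := [set S | shatters F0 S]%SET in le0.
have s1x S : S \in s1 -> x \notin S.
  by rewrite inE; apply: shatters_notin (true) _ => C; rewrite inE => /andP[].
have s0x S : S \in s0 -> x \notin S.
  rewrite inE; apply: shatters_notin (false) _ => C.
  by rewrite inE => /andP[_ /negbTE].
(* Sets shattered by both halves are counted a second time through x |: S. *)
pose add := [set x |: S | S in s1 :&: s0]%SET.
have cadd : #|add| = #|(s1 :&: s0)%SET|.
  apply: card_in_imset => S S'; rewrite 2!(finset.in_setI) => /andP[/s1x xS _].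
  move=> /andP[/s1x xS' _] /(congr1 (fun D => D :\ x)%SET).
  by rewrite !finset.setU1K.
have dis : ((s1 :|: s0) :&: add)%SET = finset.set0.
  apply/finset.setP => S; rewrite finset.in_setI finset.in_set0.
  apply/negP => /andP[SU /imsetP[S' _ SE]].
  have : x \notin S by move: SU; rewrite finset.in_setU => /orP[/s1x|/s0x].
  by rewrite SE finset.setU11.
have sub : (s1 :|: s0 :|: add)%SET \subset [set S | shatters F S]%SET.
  rewrite !finset.subUset -andbA; apply/and3P.
  split; apply/fintype.subsetP => S.
  - by rewrite !inE; apply: shatters_mono; rewrite F1E finset.subsetIl.
  - by rewrite !inE; apply: shatters_mono; rewrite F0E finset.subsetDl.
  move=> /imsetP[S' + ->]; rewrite finset.in_setI => /andP[S1 S0].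
  have xS' := s1x _ S1; move: S1 S0.
  rewrite !inE => /shattersP sh1 /shattersP sh0; apply/shattersP => C CS.
  have CxS' : (C :\ x)%SET \subset S' by rewrite finset.subDset.
  have [xC|xC] := boolP (x \in C).
    have [D + DS] := sh1 _ CxS'; rewrite inE => /andP[DF xD]; exists D => //.
    rewrite finset.setIUr DS (finset.setIidPr _) ?finset.sub1set //.
    by rewrite finset.setD1K.
  have [D + DS] := sh0 _ CxS'; rewrite inE => /andP[DF xD]; exists D => //.
  rewrite finset.setIUr DS; apply/finset.setP => z; rewrite !inE.
  by case: eqVneq => [->|_]; rewrite ?(negbTE xD) ?(negbTE xC) ?andbF.
apply: leq_trans (subset_leq_card sub); rewrite cardsU dis cards0 subn0 cadd.
have -> : (#|(s1 :|: s0)%SET| + #|(s1 :&: s0)%SET| = #|s1| + #|s0|)%N.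
  exact: cardsUI.
by rewrite cardF leq_add.
Qed.

Lemma sum_powerset_weight (R : comNzRingType) (V : finType) (x : R) :
  \sum_(S : {set V}) x ^+ #|S| = (x + 1) ^+ #|V|.
Proof.
rewrite -prodr_const bigA_distr; apply: eq_bigr => S _.
by rewrite -big_mkcond prodr_const.
Qed.

(** The number of sets shattered by F is bounded by giving each one the weight
    x^|S|, as in Chernoff's inequality: if all of them had fewer than k points,
    there would be at most x^(-k) (1 + x)^|V| <= exp(y k + x |V|) of them,
    where x = exp(-y).  For y = 2/e one has x <= 1/(1 + y) <= e/2, and
    k = (e^2/4) |V| makes the exponent at most e |V|, contradicting pajor. *)
Lemma large_shattered_set (R : realType) (V : finType) (F : {set {set V}})
    (e : R) :
  0 < e -> expR (e * #|V|%:R) < #|F|%:R ->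
  exists2 S : {set V}, shatters F S & e ^+ 2 / 4 * #|V|%:R <= #|S|%:R.
Proof.
move=> e0 ltF; apply: contrapT => noS; move: ltF; apply/negP; rewrite -leNgt.
have smallS S : shatters F S -> #|S|%:R < e ^+ 2 / 4 * #|V|%:R.
  by move=> sh; rewrite ltNge; apply/negP => leS; apply: noS; exists S.
pose y := 2 / e; pose x := expR (- y).
have x_le : x <= e / 2.
  rewrite /x expRN -[e / 2]invrK.
  rewrite lef_pV2 ?posrE ?expR_gt0 ?invr_gt0 ?divr_gt0 //.
  by rewrite invf_div (le_trans _ (expR_ge1Dx _)) // lerDr.
have sumF : #|F|%:R <= \sum_(S : {set V}) expR (e / 2 * #|V|%:R) * x ^+ #|S|.
  apply: (@le_trans _ _ #|[set S | shatters F S]%SET|%:R).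
    by rewrite ler_nat pajor.
  rewrite -sum1_card natr_sum big_mkcond /=; apply: ler_sum => S _.
  case: ifPn; rewrite inE => sh; last by rewrite mulr_ge0 ?exprn_ge0 ?expR_ge0.
  rewrite /x -expRM_natl -expRD -[leLHS]expR0 ler_expR.
  have -> : e / 2 * #|V|%:R + #|S|%:R * - y
      = 2 / e * (e ^+ 2 / 4 * #|V|%:R - #|S|%:R) :> R.
    by rewrite /y; field; exact: lt0r_neq0.
  by rewrite mulr_ge0 ?divr_ge0 ?subr_ge0 // ltW // smallS.
apply: (le_trans sumF); rewrite -mulr_sumr sum_powerset_weight.
have -> : e * #|V|%:R = e / 2 * #|V|%:R + #|V|%:R * (e / 2) by lra.
rewrite expRD ler_wpM2l ?expR_ge0 // expRM_natl lerXn2r ?nnegrE ?expR_ge0 //.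
  by rewrite addr_ge0 ?expR_ge0.
by rewrite addrC (le_trans (expR_ge1Dx _)) // ler_expR.
Qed.

(** * Independence sets inside a finite set of vertices *)

Section FiniteRestrictions.
Variables (d : nat) (T : set (word d)) (L : set T).
Hypothesis finL : finite_set L.

(** The lemmas on shattering require a finite type of points: the vertices in L
    are taken as the elements of the finite type attached to fset_set L. *)
Definition slice (a : pred T) : {set fset_set L} := [set v | a (val v)]%SET.

Lemma in_slice (a : pred T) v : (v \in slice a) = a (val v).
Proof. by rewrite finset.in_set. Qed.

Lemma card_slice (S : set T) : S `<=` L -> #|slice (mem S)| = card S.
Proof.
move=> SL; rewrite /card -(card_finset (mem (slice (mem S)))).
have -> : fset_set S = [fset val v | v in [fset v in slice (mem S)]%fset]%fset.
  have finS : finite_set S := sub_finite_set SL finL.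
  apply/fsetP => g; apply/idP/imfsetP => /=.
    rewrite in_fset_set // => gS.
    have gL : g \in fset_set L.
      by rewrite in_fset_set // inE; apply: SL; exact: set_mem.
    exists [` gL]%fset => //; rewrite !inE; exact: set_mem.
  by case=> v; rewrite !inE => vS ->; rewrite in_fset_set // inE.
by rewrite [RHS]card_imfset //; exact: val_inj.
Qed.

Definition traces (X : set (T -> bool)) : {set {set fset_set L}} :=
  [set A | `[< exists2 t, X t & slice t = A >]]%SET.

Lemma tracesP (X : set (T -> bool)) (A : {set fset_set L}) :
  reflect (exists2 t, X t & slice t = A) (A \in traces X).
Proof. by rewrite finset.in_set; exact: asboolP. Qed.

(** The traces faithfully encode the patterns of X on L: A is sent to its
    indicator function, which is restrict_to L t when A = slice t. *)
Lemma card_traces (X : set (T -> bool)) :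
  card (restrict_to L @` X) = #|traces X|.
Proof.
pose dec (A : {set fset_set L}) : L -> bool :=
  fun g => `[< exists2 v, v \in A & val v = val g >].
have in_L (v : fset_set L) : val v \in L by rewrite -(in_fset_set finL) fsvalP.
have decE A v : dec A (SigSub (in_L v)) = (v \in A).
  apply/asboolP/idP => [[w wA /val_inj <-]|vA] //.
  by exists v.
have dec_slice (t : T -> bool) : dec (slice t) = restrict_to L t.
  apply/funext => g; apply/asboolP/idP => [[v]|tg].
    by rewrite inE => + vg; rewrite vg.
  have gL : val g \in fset_set L by rewrite in_fset_set // (valP g).
  by exists [` gL]%fset => //; rewrite inE.
have -> : restrict_to L @` X = dec @` [set` [fset A in traces X]%fset].
  apply/seteqP; split => [_ [t Xt <-]|_ [A /= + <-]].
    exists (slice t) => //=; rewrite !inE.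
    by exists t.
  by rewrite !inE => -[t Xt <-]; exists t.
rewrite /card fset_set_image // set_fsetK card_imfset /=; last first.
  by move=> A B AB; apply/finset.setP => v; rewrite -!decE AB.
exact: card_finset.
Qed.

Lemma independence_shatters (X : set (T -> bool)) (S : set T) : S `<=` L ->
  independence_set X S <-> shatters (traces X) (slice (mem S)).
Proof.
move=> SL; split=> [indS|/shattersP sh u].
  apply/shattersP => B BS.
  have [t Xt tS] := indS (fun g => `[< exists2 v, v \in B & val v = val g >]).
  exists (slice t); first by apply/tracesP; exists t.
  apply/finset.setP => v; rewrite !inE; apply/andP/idP => [[tv vS]|vB].
    move: tv; rewrite (tS (SigSub vS)) => /asboolP[w wB /val_inj <-].
    exact: wB.
  have vS : val v \in S by have := fintype.subsetP BS v vB; rewrite in_slice.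
    split => //.
  by rewrite (tS (SigSub vS)); apply/asboolP; exists v.
pose B := [set v : fset_set L | `[< exists2 g : S, val g = val v & u g >]]%SET.
have [|A] := sh B.
  apply/fintype.subsetP => v; rewrite finset.in_set => /asboolP[g gv _].
  by rewrite in_slice -gv; exact: valP.
move=> /tracesP[t Xt <-] tB; exists t => // g.
have gS : val g \in S := valP g.
have gL : val g \in fset_set L.
  by rewrite in_fset_set // inE; apply: SL; exact: set_mem.
move/finset.setP: tB => /(_ [` gL]%fset).
rewrite finset.in_setI !in_slice finset.in_set /= gS andbT => ->.
apply/asboolP/idP => [[g' /val_inj <-]|ug] //.
by exists g.
Qed.

Lemma independence_card (X : set (T -> bool)) (S : set T) :
  S `<=` L -> independence_set X S ->
  (2 ^ card S <= card (restrict_to L @` X))%N.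
Proof.
move=> SL /(independence_shatters X SL) /shatters_card.
by rewrite card_slice // card_traces.
Qed.

Lemma large_independence_set (R : realType) (X : set (T -> bool)) (e : R) :
  0 < e -> expR (e * (card L)%:R) < (card (restrict_to L @` X))%:R ->
  exists S : set T, [/\ S `<=` L, independence_set X S
    & e ^+ 2 / 4 * (card L)%:R <= (card S)%:R].
Proof.
have cardL : #|{: fset_set L}| = card L by rewrite -cardfE.
rewrite card_traces -cardL => e0 /(large_shattered_set e0)[A shA leA].
pose S : set T := [set g | exists2 v, v \in A & val v = g].
have SL : S `<=` L.
  by move=> _ [v _ <-]; have := fsvalP v; rewrite in_fset_set // inE.
have sliceS : slice (mem S) = A.
  apply/finset.setP => v; rewrite in_slice; apply/idP/idP => [|vA].
    by move/set_mem => [w wA /val_inj <-].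
  by apply: mem_set; exists v.
exists S; split => //.
  by apply/(independence_shatters X SL); rewrite sliceS.
by rewrite -card_slice // sliceS.
Qed.

End FiniteRestrictions.

(** * Counting in finite sets *)

Section Card.
Variable U : choiceType.
Implicit Types A B : set U.

Lemma le_card A B : finite_set B -> A `<=` B -> (card A <= card B)%N.
Proof.
move=> finB AB; apply: fsubset_leq_card.
by rewrite -fset_set_sub //; exact: sub_finite_set finB.
Qed.

Lemma le_card_setU A B : finite_set A -> finite_set B ->
  (card (A `|` B) <= card A + card B)%N.
Proof.
by move=> finA finB; rewrite /card fset_setU // cardfsU leq_subr.
Qed.

(** Overlaps between the F i only increase the sum, so a covering suffices. *)
Lemma le_card_sum (l : nat) (F : nat -> set U) A :
  finite_set A -> A `<=` \bigcup_(i in `I_l) F i ->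
  (card A <= \sum_(i < l) card (A `&` F i))%N.
Proof.
elim: l A => [|l IH] A finA AF.
  have -> : A = set0 by move: AF; rewrite II0 bigcup_set0 subset0.
  by rewrite /card fset_set0 cardfs0.
rewrite big_ord_recr /=.
have finD : finite_set (A `\` F l) by exact: finite_setD.
apply: (@leq_trans (card (A `\` F l) + card (A `&` F l))).
  rewrite -[in leqLHS](setDUK (@subIsetl _ A (F l))) setUC setDIr setDv set0U.
  by apply: le_card_setU => //; exact: finite_setIl.
rewrite leq_add2r; apply: leq_trans (IH _ finD _) _.
  move=> g [Ag nFg]; have [i /= il Fig] := AF g Ag.
  exists i => //=; rewrite ltnS leq_eqVlt in il.
  by case/predU1P: il Fig => [->|].
apply: leq_sum => i _; apply: le_card; first exact: finite_setIl.
by move=> g [[]].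
Qed.

End Card.

Lemma pigeonhole_card (R : realType) (U : choiceType) (l : nat)
    (F : nat -> set U) (A : set U) (c : R) :
  finite_set A -> A `<=` \bigcup_(i in `I_l) F i -> 0 < c -> c <= (card A)%:R ->
  exists2 i, (i < l)%N & c / l%:R <= (card (A `&` F i))%:R.
Proof.
move=> finA AF c0 cA; apply: contrapT => small.
have l0 : (0 < l)%N.
  rewrite lt0n; apply: contraTneq cA => l0; move: AF.
  rewrite l0 II0 bigcup_set0 subset0 => ->.
  by rewrite /card fset_set0 cardfs0 -ltNge.
have := le_card_sum finA AF; rewrite -(ler_nat R) natr_sum.
apply/negP; rewrite -ltNge; apply: lt_le_trans cA.
have -> : c = \sum_(i < l) c / l%:R.
  by rewrite sumr_const card_ord -[RHS]mulr_natr divfK // pnatr_eq0 -lt0n.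
apply: ltr_sum => [|i _].
  by apply/hasP; exists (Ordinal l0) => //; exact: mem_index_enum.
rewrite ltNge; apply/negP => ?; apply: small.
by exists (val i) => //; exact: ltn_ord.
Qed.

(** * Levels and balls of an expandable tree *)

Section Levels.
Variables (d : nat) (T : set (word d)).

Lemma finite_level n : finite_set (level T n).
Proof.
have finW : finite_set [set w : word d | size w = n].
  apply: (@sub_finite_set _ _ [set tval t | t in [set: n.-tuple 'I_d]]).
    by move=> w /= /eqP wn; exists (Tuple wn).
  exact: finite_image.
apply: sub_finite_set (finite_preimage (in2W val_inj) finW).
by move=> g.
Qed.

Lemma initialE n : initial T n = [set g | (size (val g) <= n)%N].
Proof.
apply/seteqP; split=> [g [i /= ilen]|g gn].
  by rewrite /level /= => ->.
by exists (size (val g)).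
Qed.

Lemma initialS n : initial T n.+1 = initial T n `|` level T n.+1.
Proof.
rewrite !initialE; apply/seteqP; split => g /=; rewrite /level /=.
  by rewrite leq_eqVlt ltnS => /predU1P[]; [right|left].
by case=> [/leqW|->].
Qed.

Lemma finite_initial n : finite_set (initial T n).
Proof.
elim: n => [|n IH].
  apply: sub_finite_set (finite_level 0) => g.
  by rewrite initialE /level /= leqn0 => /eqP.
by rewrite initialS finite_setU; split => //; exact: finite_level.
Qed.

Lemma level_sub_initial n : level T n `<=` initial T n.
Proof. by rewrite initialE /level => g /= ->. Qed.

(** Fix r strictly between 1 and the expanding number; then
    |T_(n+1)| >= r |T_n| for n >= N.  A bound |Delta_n| <= C |T_n| passes to
    n + 1 as soon as C/r + 1 <= C, that is r/(r - 1) <= C; adding |Delta_N| to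
    C makes it hold at n = N. *)
Lemma initial_le_level (R : realType) : expandable R T ->
  exists2 C : R, 0 < C & exists N, forall n, (N <= n)%N ->
    (0 < card (level T n))%N /\
    (card (initial T n))%:R <= C * (card (level T n))%:R.
Proof.
move=> [cv gt1].
pose r : R := (1 + expanding_number R T) / 2.
have r1 : 1 < r by rewrite /r; lra.
have rlt : r < expanding_number R T by rewrite /r; lra.
have [N _ ratioN] : \forall n \near \oo, r < growth_ratio R T n.
  exact: cvgr_gt cv _ rlt.
(* At an empty level the ratio would be a division by zero, of value 0. *)
have lev0 n : (N <= n)%N -> (0 < card (level T n))%N.
  move=> Nn; rewrite lt0n; apply/eqP => l0.
  by have := ratioN n Nn; rewrite /growth_ratio l0 invr0 mulr0; lra.
have levS n : (N <= n)%N ->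
    r * (card (level T n))%:R <= (card (level T n.+1))%:R.
  move=> Nn; apply: ltW; rewrite -ltr_pdivlMr ?ltr0n ?lev0 //.
  exact: ratioN.
pose C : R := (card (initial T N))%:R + r / (r - 1).
have Cr : r / (r - 1) <= C by rewrite /C lerDr.
have C0 : 0 < C by apply: lt_le_trans Cr; rewrite divr_gt0; lra.
exists C => //; exists N => n Nn; split; first exact: lev0.
rewrite -(subnKC Nn); elim: (n - N)%N => [|k IH].
  rewrite addn0.
  have : (1 : R) <= (card (level T N))%:R by rewrite ler1n lev0.
  have : 0 <= r / (r - 1) by rewrite divr_ge0; lra.
  rewrite /C; have : 0 <= (card (initial T N))%:R :> R by [].
  by nra.
rewrite addnS; set m := (N + k)%N in IH *.
have := levS m (leq_addr _ _).
have : (card (initial T m.+1))%:R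
    <= (card (initial T m))%:R + (card (level T m.+1))%:R :> R.
  rewrite -natrD ler_nat initialS le_card_setU //.
    exact: finite_initial.
  exact: finite_level.
move=> cea rba; apply: (le_trans cea).
have rC : r <= C * (r - 1) by rewrite -ler_pdivrMr //; lra.
have r0 : 0 < r by lra.
have a0 : 0 <= (card (level T m.+1))%:R :> R by [].
rewrite -(ler_pM2l r0).
have := ler_wpM2r a0 rC; have := ler_wpM2l (ltW C0) rba.
by have := ler_wpM2l (ltW r0) IH; lra.
Qed.
End Levels.

(** * Positive upper limits *)

Section PositiveLimsup.
Local Open Scope ereal_scope.
Variables (R : realType) (u : nat -> \bar R).

Lemma limn_esup_gt0 : 0 < limn_esup u <->
  exists2 e : R, (0 < e)%R & forall N, exists2 n, (N <= n)%N & e%:E < u n.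
Proof.
split=> [gt0|[e e0 freq]].
  have [e e0 lte] : exists2 e : R, (0 < e)%R & e%:E < limn_esup u.
    case: (limn_esup u) gt0 => [x| |] //; last first.
      by exists 1%R => //; rewrite ltry.
    by rewrite lte_fin => x0; exists (x / 2)%R; rewrite ?lte_fin; lra.
  exists e => // N.
  have : e%:E < ereal_sup (u @` [set n | (N <= n)%N]).
    apply: lt_le_trans lte _; apply: ereal_inf_lbound.
    by exists [set n | (N <= n)%N] => //; exists N.
  by move=> /ereal_sup_gt[_ [n Nn <-] ?]; exists n.
apply: (@lt_le_trans _ _ e%:E); first by rewrite lte_fin.
apply/ereal_infP => _ [A [N _ NA] <-].
have [n Nn en] := freq N.
apply: (le_trans (ltW en)); apply: ereal_sup_ubound.
by exists n => //; exact: NA.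
Qed.

End PositiveLimsup.

(** The case p = 0 is included: then lne p is -oo and both sides are false. *)
Lemma lt_lne_ratio (R : realType) (e : R) (p m : nat) :
  0 < e -> (0 < m)%N ->
  (e%:E < lne p%:R%:E / m%:R%:E)%E = (expR (e * m%:R) < p%:R).
Proof.
move=> e0 m0; rewrite inver gt_eqF ?ltr0n //.
have [->|p0] := posnP p.
  rewrite le0_lneNy // mulNyr gtr0_sg ?invr_gt0 ?ltr0n // mul1e.
  by rewrite ltNge leNye /= ltNge expR_ge0.
rewrite lne_EFin ?ltr0n // -EFinM lte_fin ltr_pdivlMr ?ltr0n //.
by rewrite -[in RHS](@lnK _ p%:R) ?posrE ?ltr0n // ltr_expR.
Qed.

(** * Surface entropy and boundary independence *)

Section EntropyIndependence.
Variables (R : realType) (d : nat) (T : set (word d)) (X : set (T -> bool)).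

Lemma entropy_boundary_independence : expandable R T ->
  (0 < surface_entropy R X)%E -> boundary_independence R X.
Proof.
move=> /initial_le_level[C C0 [N levN]] /limn_esup_gt0[e e0 freq].
(* An empty shift has entropy -oo; a point of X makes set0 independent, which
   serves as S_n at the levels with too few patterns. *)
have [t0 Xt0] : exists t, X t.
  apply: contrapT => X0; have [n /levN[n0 _]] := freq N.
  rewrite lt_lne_ratio //; have -> : X = set0.
    by apply/seteqP; split=> // t Xt; apply: X0; exists t.
  by rewrite /level_patterns image_set0 /card fset_set0 cardfs0 ltNge expR_ge0.
have /choice[S SP] : forall n, exists S : set T,
    [/\ S `<=` level T n, independence_set X S &
      expR (e * (card (level T n))%:R) < (card (level_patterns X n))%:R :> R ->
      e ^+ 2 / 4 * (card (level T n))%:R <= (card S)%:R].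
  move=> n.
  have [big|small] := boolP
      (expR (e * (card (level T n))%:R) < (card (level_patterns X n))%:R).
    have finL := @finite_level d T n.
    have [S [SL indS leS]] := large_independence_set finL e0 big.
    by exists S.
  exists set0; split => //.
  by move=> u; exists t0 => // -[g g0]; case: (set_mem g0).
exists 1%N, S; split => // [n n1 g Sg|n n1|].
- have [SL _ _] := SP n; have gn := SL g Sg.
  split; first exact: level_sub_initial.
  rewrite initialE /= gn; case: n n1 {Sg SL gn} => // n _.
  by rewrite subn1 ltnn.
- by have [] := SP n.
(* The density is at least (e^2/4)/C; halving it makes the bound strict. *)
apply/limn_esup_gt0; exists (e ^+ 2 / 8 / C) => [|M].
  by rewrite !divr_gt0 ?exprn_gt0.
have [n] := freq (maxn M N); rewrite geq_max => /andP[Mn /levN[n0 leC]].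
rewrite lt_lne_ratio // => big; exists n => //.
have [SL _ /(_ big) leS] := SP n.
have -> : S n `&` initial T n = S n.
  by apply/setIidPl => g /SL; exact: level_sub_initial.
have i0 : 0 < (card (initial T n))%:R :> R.
  rewrite ltr0n (leq_trans n0) // le_card //; first exact: finite_initial.
  exact: level_sub_initial.
rewrite /= lte_fin ltr_pdivlMr //; apply: lt_le_trans leS.
have n0R : 0 < (card (level T n))%:R :> R by rewrite ltr0n.
apply: (@le_lt_trans _ _ (e ^+ 2 / 8 * (card (level T n))%:R)).
  rewrite -[leLHS]mulrA ler_wpM2l ?divr_ge0 ?sqr_ge0 //.
  by rewrite ler_pdivrMl.
by rewrite ltr_pM2r //; have := exprn_gt0 2 e0; lra.
Qed.

Lemma boundary_independence_entropy :
  boundary_independence R X -> (0 < surface_entropy R X)%E.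
Proof.
move=> [l [S [l1 S_sub indS /limn_esup_gt0[e e0 freq]]]].
have ln2 : 0 < ln (2 : R) by rewrite ln_gt0 // ltr1n.
(* Half of (e/l) ln 2, in order to have a strict bound. *)
have rate0 : 0 < e / l%:R * ln 2 / 2.
  apply: divr_gt0 => //; apply: mulr_gt0 => //.
  by apply: divr_gt0 => //; rewrite ltr0n.
apply/limn_esup_gt0; exists (e / l%:R * ln 2 / 2) => // M.
(* Going l levels further ensures that the level j found below is at least M. *)
have [n Mln /= densn] := freq (M + l)%N.
have l_le_n : (l <= n)%N by lia.
have SI : S n `&` initial T n = S n by apply/setIidPl => g /(S_sub n l_le_n)[].
have finS : finite_set (S n) by rewrite -SI; exact/finite_setIr/finite_initial.
rewrite SI lte_fin in densn.
have i0 : (0 < card (initial T n))%N.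
  rewrite lt0n; apply: contraTneq densn => ->.
  by rewrite invr0 mulr0 ltNge ltW.
pose c := e * (card (initial T n))%:R.
have cS : c <= (card (S n))%:R by rewrite -ler_pdivlMr ?ltr0n // ltW.
have c0 : 0 < c by rewrite mulr_gt0 ?ltr0n.
have covS : S n `<=` \bigcup_(i in `I_l) level T (n - i).
  move=> g /(S_sub n l_le_n); rewrite !initialE => -[/= gn /negP].
  rewrite -ltnNge => gnl; exists (n - size (val g))%N => /=; first by lia.
  by rewrite /level /= subKn.
have [i il ci] := pigeonhole_card finS covS c0 cS.
set j := (n - i)%N in ci; exists j; first by rewrite /j; lia.
pose A := S n `&` level T j.
have AL : A `<=` level T j by move=> g [].
have indA : independence_set X A.
  (* Prescribe u on the part of S n in level j, and false elsewhere. *)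
  move=> u; have [t Xt tS] := indS n l_le_n (fun g =>
    if pselect (val g \in A) is left gA then u (SigSub gA) else false).
  exists t => // -[g gA].
  have gS : g \in S n by apply: mem_set; case/set_mem: gA.
  rewrite (tS (SigSub gS)) /=; case: pselect => // gA'.
  by congr u; exact: val_inj.
have finj := @finite_level d T j.
have lj : (card (level T j) <= card (initial T n))%N.
  apply: le_card; first exact: finite_initial.
  by rewrite initialE => g; rewrite /level /= => ->; exact: leq_subr.
have lA : e / l%:R * (card (level T j))%:R <= (card A)%:R.
  apply: le_trans ci; rewrite /c mulrAC ler_pM2r ?invr_gt0 ?ltr0n //.
  by rewrite ler_pM2l // ler_nat.
have A0 : 0 < (card A)%:R :> R.
  by apply: lt_le_trans ci; rewrite divr_gt0 ?ltr0n.
have j0 : (0 < card (level T j))%N.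
  by rewrite (leq_trans _ (le_card finj AL)) // -(ltr0n R).
rewrite lt_lne_ratio //.
have := independence_card finj AL indA; rewrite -(ler_nat R) natrX.
apply: lt_le_trans; rewrite -[ltRHS]lnK ?posrE ?exprn_gt0 // ltr_expR.
rewrite lnXn // -[ltRHS]mulr_natl.
have -> : e / l%:R * ln 2 / 2 * (card (level T j))%:R
   = (e / l%:R * (card (level T j))%:R) * (ln 2 / 2) by lra.
apply: (@le_lt_trans _ _ ((card A)%:R * (ln 2 / 2))).
  by rewrite ler_wpM2r //; lra.
by rewrite ltr_pM2l //; lra.
Qed.

End EntropyIndependence.

Local Open Scope ereal_scope.

Theorem theorem1p7 (R : realType) (d : nat) (T : set (word d))
    (hT : is_tree T) (hexp : expandable R T)
    (X : set (T -> bool)) (hX : is_tree_shift X) :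
  0 < surface_entropy R X <-> boundary_independence R X.
Proof.
split; first exact: entropy_boundary_independence.
exact: boundary_independence_entropy.
Qed.
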